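(* Let $M \cong P/C$ with $C \in \mathfrak{Grass}^T_{\mathbf d}$. Then the following statements are equivalent: (1) $M$ has no proper unipotent top-stable degenerations. (2) $\mathrm{Aut}_\Lambda(P)_u.C = \{C\}$, that is, $C$ is stable under all maps in $\mathrm{Hom}_\Lambda(P, JP)$. (3) $\mathfrak m = 0$, where $\mathfrak m = \dim_K \mathrm{Hom}_\Lambda(P, JP/C) - \dim_K \mathrm{Hom}_\Lambda(P/C, JP/C)$.
   Context: $K$ is an algebraically closed field and $\Lambda$ is a basic finite dimensional $K$-algebra with Jacobson radical $J$. Modules are finite dimensional left $\Lambda$-modules. $T$ is a semisimple module with projective cover $P$, and $\mathbf d$ is a dimension vector with sum of entries $|\mathbf d|$. $\mathfrak{Grass}^T_{\mathbf d}$ is the closed subvariety of the Grassmannian $\mathrm{Gr}(\dim P-|\mathbf d|,P)$ consisting of those subspaces $C$ that are $\Lambda$-submodules of $JP$ with $P/C$ of dimension vector $\mathbf d$; $\mathrm{Aut}_\Lambda(P)$ acts on it morphically. The unipotent radical of $\mathrm{Aut}_\Lambda(P)$ is $\mathrm{Aut}_\Lambda(P)_u=\{\mathrm{id}_P+f\mid f\in\mathrm{Hom}_\Lambda(P,JP)\}$. A unipotent top-stable degeneration of $M\cong P/C$ is a module $M'\cong P/C'$ with $C'$ in the closure of $\mathrm{Aut}_\Lambda(P)_u.C$ in $\mathfrak{Grass}^T_{\mathbf d}$; it is proper if $M'\not\cong M$. *)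

(* Defs.v *)
(* MathComp; classical logic from mathcomp.classical.boolp. *)
From HB Require Import structures.
From mathcomp Require Import all_boot all_order all_algebra all_field.
From mathcomp Require Import boolp.
From mathcomp Require Import mpoly.

Set Implicit Arguments.
Unset Strict Implicit.
Unset Printing Implicit Defensive.

Import GRing.Theory.
Local Open Scope ring_scope.

Section SubspaceOfPred.
Variables (K : fieldType) (V : vectType K) (S : V -> Prop).
Hypotheses (S0 : S 0) (SL : forall (a : K) u v, S u -> S v -> S (a *: u + v)).

Lemma vspace_of_ex : exists U : {vspace V}, forall v, v \in U <-> S v.
Proof.
pose inS (U : {vspace V}) := forall v, v \in U -> S v.
have ex0 : exists d, `[< exists2 U, inS U & \dim U = d >].
  by exists 0%N; apply/asboolP; exists 0%VS => [v|]; rewrite ?dimv0 // memv0 => /eqP->.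
have bnd d : `[< exists2 U, inS U & \dim U = d >] -> (d <= \dim {:V})%N.
  by move/asboolP => [U _ <-]; apply/dimvS/subvf.
case: (ex_maxnP ex0 bnd) => d /asboolP [U SU dU] dmax.
exists U => v; split; first exact: SU.
move=> Sv; have SUv : inS (U + <[v]>)%VS.
  move=> w /memv_addP [u Uu [x /vlineP [c ->] ->]].
  by rewrite addrC; apply: SL => //; apply: SU.
have /dmax le : `[< exists2 U', inS U' & \dim U' = \dim (U + <[v]>) >].
  by apply/asboolP; exists (U + <[v]>)%VS.
have /eqP -> : (U == U + <[v]>)%VS by rewrite eqEdim addvSl dU.
by rewrite -[v in v \in _]add0r memv_add ?mem0v ?memv_line.
Qed.

Definition vspace_of : {vspace V} := sval (cid vspace_of_ex).

Lemma vspace_ofP v : v \in vspace_of <-> S v.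
Proof. exact: (svalP (cid vspace_of_ex)). Qed.

End SubspaceOfPred.

(* A finite dimensional left module: a finite dimensional K-space with a unital
   K-algebra homomorphism to its endomorphisms. *)
Record fdmod (K : fieldType) (A : falgType K) := FDMod {
  fd_carrier :> vectType K;
  act : A -> 'End(fd_carrier);
  act_linear : linear act;
  act1 : act 1 = \1%VF;
  actM : forall a b, act (a * b) = (act a \o act b)%VF }.
Arguments act {K A} f a : rename.

Record submodule (K : fieldType) (A : falgType K) (M : fdmod A) := Submodule {
  sm_vspace :> {vspace M};
  sm_stable : forall a, (act M a @: sm_vspace <= sm_vspace)%VS }.

Section Modules.
Variables (K : fieldType) (A : falgType K).
Implicit Types M N P : fdmod A.

Lemma fdhom_zero M N a : ((0 : 'Hom(M, N)) \o act M a = act N a \o 0)%VF.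
Proof. by rewrite comp_lfun0l comp_lfun0r. Qed.

Lemma fdhom_lin M N (c : K) (f g : 'Hom(M, N)) :
  (forall a, (f \o act M a = act N a \o f)%VF) ->
  (forall a, (g \o act M a = act N a \o g)%VF) ->
  forall a, ((c *: f + g) \o act M a = act N a \o (c *: f + g))%VF.
Proof.
move=> Hf Hg a.
by rewrite comp_lfunDl comp_lfunDr -comp_lfunZl -comp_lfunZr Hf Hg.
Qed.

Definition fdhom M N : {vspace 'Hom(M, N)} :=
  vspace_of (@fdhom_zero M N) (@fdhom_lin M N).

Lemma fdhomP M N (f : 'Hom(M, N)) :
  f \in fdhom M N <-> forall a, (f \o act M a = act N a \o f)%VF.
Proof. exact: vspace_ofP. Qed.

Definition mod_iso M N : Prop :=
  exists f, [/\ f \in fdhom M N, lker f = 0%VS & limg f = fullv].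

Section SubMod.
Variables (M : fdmod A) (U : submodule M).

Definition sub_act (a : A) : 'End(subvs_of U) :=
  (linfun (vsproj U) \o act M a \o linfun vsval)%VF.

Lemma sub_actE a x : vsval (sub_act a x) = act M a (vsval x).
Proof.
rewrite /sub_act !comp_lfunE !lfunE /= vsprojK //.
by apply: (subvP (sm_stable U a)); rewrite memv_img // subvsP.
Qed.

Lemma sub_act_linear : linear sub_act.
Proof.
move=> c a b; apply/lfunP=> x; apply: val_inj => /=.
by rewrite sub_actE act_linear add_lfunE scale_lfunE -!sub_actE add_lfunE scale_lfunE.
Qed.

Lemma sub_act1 : sub_act 1 = \1%VF.
Proof. by apply/lfunP=> x; apply: val_inj; rewrite /= sub_actE act1 !lfunE. Qed.

Lemma sub_actM a b : sub_act (a * b) = (sub_act a \o sub_act b)%VF.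
Proof.
apply/lfunP=> x; apply: val_inj; rewrite [in RHS]comp_lfunE.
by rewrite /= !sub_actE actM comp_lfunE.
Qed.

Definition sub_mod : fdmod A := FDMod sub_act_linear sub_act1 sub_actM.

Definition incl : 'Hom(sub_mod, M) := linfun vsval.

Lemma inclE x : incl x = vsval x.
Proof. exact: lfunE. Qed.

Lemma incl_hom : incl \in fdhom sub_mod M.
Proof. apply/fdhomP=> a; apply/lfunP=> x; rewrite [LHS]comp_lfunE [RHS]comp_lfunE.
by rewrite !inclE; apply: sub_actE. Qed.

Lemma incl_inj : lker incl = 0%VS.
Proof.
apply/eqP; rewrite -subv0; apply/subvP=> x; rewrite memv_ker inclE memv0.
by move=> /eqP h; apply/eqP/val_inj.
Qed.

Lemma limg_incl : limg incl = U.
Proof.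
apply/vspaceP=> v; apply/memv_imgP/idP=> [[x _ ->]|Uv].
  by rewrite inclE subvsP.
by exists (vsproj U v); rewrite ?memvf // inclE vsprojK.
Qed.

End SubMod.

(* M / C is carried by the chosen linear complement of C; quot_proj is then a
   surjective module homomorphism with kernel C. *)
Section Quotient.
Variables (M : fdmod A) (C : submodule M).

Let W : {vspace M} := (C^C)%VS.

Definition quot_fun : 'Hom(M, subvs_of W) :=
  (linfun (vsproj W) \o daddv_pi W C)%VF.

Lemma quot_compl : (W :&: C = 0)%VS.
Proof. by rewrite capvC capv_compl. Qed.

Lemma quot_funK x : quot_fun (vsval x) = x.
Proof.
rewrite /quot_fun comp_lfunE lfunE /= daddv_pi_id ?quot_compl ?subvsP //.
exact: vsvalK.
Qed.

Lemma lker_quot_fun : lker quot_fun = C.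
Proof.
have dec v : v = daddv_pi W C v + daddv_pi C W v.
  by rewrite daddv_pi_add ?quot_compl // addvC addv_complf memvf.
apply/vspaceP=> v; rewrite memv_ker /quot_fun comp_lfunE lfunE /=.
apply/eqP/idP=> [/(congr1 vsval)|Cv].
  rewrite vsprojK ?memv_pi // => h; rewrite [v]dec h /= add0r; exact: memv_pi.
apply: val_inj; rewrite /= vsprojK ?memv_pi //.
have := dec v; rewrite (@daddv_pi_id _ _ C) ?capv_compl // => /(canLR (addrK _)).
by rewrite subrr => <-.
Qed.

Definition quot_act (a : A) : 'End(subvs_of W) :=
  (quot_fun \o act M a \o linfun vsval)%VF.

Lemma quot_actE a v : quot_act a (quot_fun v) = quot_fun (act M a v).
Proof.
have -> : quot_act a (quot_fun v) = quot_fun (act M a (vsval (quot_fun v))).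
  by rewrite /quot_act comp_lfunE comp_lfunE (lfunE vsval).
apply/eqP; rewrite -subr_eq0 -[_ - _](linearB quot_fun) -(linearB (act M a)).
rewrite -memv_ker lker_quot_fun; apply: (subvP (sm_stable C a)).
have : vsval (quot_fun v) - v \in lker quot_fun.
  by rewrite memv_ker linearB /= quot_funK subrr.
by rewrite lker_quot_fun => /(memv_img (act M a)).
Qed.

Lemma quot_act_linear : linear quot_act.
Proof.
move=> c a b; apply/lfunP=> x.
by rewrite -(quot_funK x) add_lfunE scale_lfunE !quot_actE act_linear add_lfunE scale_lfunE linearP.
Qed.

Lemma quot_act1 : quot_act 1 = \1%VF.
Proof. by apply/lfunP=> x; rewrite -(quot_funK x) quot_actE act1 !lfunE. Qed.

Lemma quot_actM a b : quot_act (a * b) = (quot_act a \o quot_act b)%VF.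
Proof.
by apply/lfunP=> x; rewrite -(quot_funK x) comp_lfunE !quot_actE actM comp_lfunE.
Qed.

Definition quot_mod : fdmod A := FDMod quot_act_linear quot_act1 quot_actM.

Definition quot_proj : 'Hom(M, quot_mod) := quot_fun.

Lemma quot_proj_hom : quot_proj \in fdhom M quot_mod.
Proof. apply/fdhomP=> a; apply/lfunP=> x; rewrite [LHS]comp_lfunE [RHS]comp_lfunE.
exact/esym/quot_actE. Qed.

Lemma lker_quot_proj : lker quot_proj = C.
Proof. exact: lker_quot_fun. Qed.

Lemma limg_quot_proj : limg quot_proj = fullv.
Proof.
apply/vspaceP=> x; rewrite memvf; apply/memv_imgP.
by exists (vsval x); rewrite ?memvf ?quot_funK.
Qed.

(* U / C for C <= U, as the submodule {x + C | x in U} of M / C. *)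
Lemma sub_quot_stable (U : submodule M) a :
  (act quot_mod a @: (quot_proj @: U) <= quot_proj @: U)%VS.
Proof.
have /fdhomP/(_ a) H := quot_proj_hom.
by rewrite -limg_comp -H limg_comp limgS // sm_stable.
Qed.

Definition sub_quot (U : submodule M) : submodule quot_mod :=
  Submodule (sub_quot_stable U).
End Quotient.

Definition simple_mod M : Prop :=
  (fullv : {vspace M}) <> 0%VS /\
  forall U : submodule M, (U : {vspace M}) = 0%VS \/ (U : {vspace M}) = fullv.

Definition semisimple_mod M : Prop :=
  exists (n : nat) (S : 'I_n -> submodule M),
    [/\ forall i, simple_mod (sub_mod (S i)),
        directv (\sum_i S i)%VS & (\sum_i S i)%VS = fullv].

Definition projective_mod P : Prop :=
  forall M N (g : 'Hom(M, N)) (f : 'Hom(P, N)),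
    g \in fdhom M N -> limg g = fullv -> f \in fdhom P N ->
    exists2 h, h \in fdhom P M & (g \o h)%VF = f.

Definition superfluous M (U : {vspace M}) : Prop :=
  forall W : submodule M, (U + W)%VS = fullv -> (W : {vspace M}) = fullv.

Definition is_projective_cover P T : Prop :=
  projective_mod P /\
  exists p, [/\ p \in fdhom P T, limg p = fullv & superfluous (lker p)].

Fact amull_linear : linear (@amull K A).
Proof. exact: linearP. Qed.

Fact amullM_comp (a b : A) : amull (a * b) = (amull a \o amull b)%VF.
Proof. by apply/lfunP=> x; rewrite comp_lfunE !lfunE /= mulrA. Qed.

Definition regular_mod : fdmod A := FDMod amull_linear (@amull1 K A) amullM_comp.

Definition maximal_left_ideal (I : submodule regular_mod) : Prop :=
  (I : {vspace A}) <> fullv /\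
  forall I' : submodule regular_mod, (I <= I')%VS ->
    (I' : {vspace A}) = I \/ (I' : {vspace A}) = fullv.

Let in_rad (x : A) := forall I, maximal_left_ideal I -> x \in (I : {vspace A}).

Fact in_rad0 : in_rad 0. Proof. by move=> I _; rewrite mem0v. Qed.
Fact in_radL (c : K) x y : in_rad x -> in_rad y -> in_rad (c *: x + y).
Proof. by move=> Hx Hy I mI; rewrite memvD ?memvZ ?Hx ?Hy. Qed.

Definition jacobson_radical : {vspace A} := vspace_of in_rad0 in_radL.

Lemma jacobson_radicalP x : x \in jacobson_radical <->
  forall I, maximal_left_ideal I -> x \in (I : {vspace A}).
Proof. exact: vspace_ofP. Qed.

Lemma jacobson_radical_mull a x :
  x \in jacobson_radical -> a * x \in jacobson_radical.
Proof.
move=> /jacobson_radicalP Jx; apply/jacobson_radicalP=> I mI.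
have -> : a * x = act regular_mod a x by rewrite /= lfunE.
by apply: (subvP (sm_stable I a)); rewrite memv_img // Jx.
Qed.

(* J M, the span of the products a m with a in J; see mem_rad_vs, rad_vs_min. *)
Definition rad_vs M : {vspace M} :=
  (\sum_(a <- vbasis jacobson_radical) limg (act M a))%VS.

Fact rad_vs_min M (U : {vspace M}) :
  (forall a v, a \in jacobson_radical -> act M a v \in U) -> (rad_vs M <= U)%VS.
Proof.
move=> HU; rewrite /rad_vs big_tnth; apply/subv_sumP => i _.
apply/subvP=> _ /memv_imgP [v _ ->]; apply: HU.
by apply: vbasis_mem; apply: (mem_tnth i (in_tuple _)).
Qed.

Fact act_linear_l M (v : M) : linear (fun a => act M a v).
Proof. by move=> c a b; rewrite act_linear add_lfunE scale_lfunE. Qed.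

Fact mem_rad_vs M a v : a \in jacobson_radical -> act M a v \in rad_vs M.
Proof.
move=> Ja; rewrite (coord_vbasis Ja).
have act_sum (I : Type) (r : seq I) (c : I -> K) (F : I -> A) :
    act M (\sum_(i <- r) c i *: F i) v = \sum_(i <- r) c i *: act M (F i) v.
  elim: r => [|i r IHr]; last by rewrite !big_cons act_linear_l IHr.
  rewrite !big_nil; have := act_linear_l v 1 0 0.
  by rewrite !scale1r addr0 => /(canLR (addrK _)); rewrite subrr => <-.
rewrite act_sum; apply: memv_suml => i _; apply: memvZ.
rewrite /rad_vs (big_nth 0) size_tuple big_mkord.
apply: (subvP (sumv_sup i isT (subvv _))); exact: memv_img (memvf v).
Qed.

Fact rad_stable M a : (act M a @: rad_vs M <= rad_vs M)%VS.
Proof.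
apply/subvP=> _ /memv_imgP [v Jv ->]; rewrite memv_preim.
apply: subvP v Jv; apply: rad_vs_min => b v Jb.
by rewrite -memv_preim -comp_lfunE -actM mem_rad_vs // jacobson_radical_mull.
Qed.

Definition rad_mod M : submodule M := Submodule (@rad_stable M).

Definition idempotent_elt (x : A) : Prop := x * x = x.

Definition primitive_idempotent (x : A) : Prop :=
  [/\ x <> 0, idempotent_elt x &
      forall y z, idempotent_elt y -> idempotent_elt z ->
        y * z = 0 -> z * y = 0 -> x = y + z -> y = 0 \/ z = 0].

Fact principal_stable (x : A) (a : A) :
  (act regular_mod a @: limg (amulr x) <= limg (amulr x))%VS.
Proof.
apply/subvP=> _ /memv_imgP [_ /memv_imgP [y _ ->] ->].
apply/memv_imgP; exists (a * y); rewrite ?memvf //.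
by rewrite !lfunE /= mulrA.
Qed.

(* The left ideal A x. *)
Definition principal (x : A) : submodule regular_mod :=
  Submodule (principal_stable x).

Definition complete_primitive_idempotents n (e : 'I_n -> A) : Prop :=
  [/\ forall i, primitive_idempotent (e i),
      forall i j, i != j -> e i * e j = 0 &
      \sum_i e i = 1].

(* A is basic, as witnessed by e. *)
Definition basic_idempotents n (e : 'I_n -> A) : Prop :=
  complete_primitive_idempotents e /\
  forall i j, i != j ->
    ~ mod_iso (sub_mod (principal (e i))) (sub_mod (principal (e j))).

(* dim e_i M: over an algebraically closed field, the multiplicity in M of the
   simple top of A e_i. *)
Definition dim_vector n (e : 'I_n -> A) M (i : 'I_n) : nat :=
  \dim (limg (act M (e i))).

End Modules.

(* The Grassmannian Gr(k, V), as the set of C with \dim C = k, with the Zariski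
   topology coming from the Pluecker embedding. *)
Section Grassmannian.
Variables (K : fieldType) (V : vectType K) (k : nat).

Definition pluecker_index : {set {ffun 'I_k -> 'I_(\dim {:V})}} :=
  [set f : {ffun 'I_k -> 'I_(\dim {:V})} |
    [forall i : 'I_k, forall j : 'I_k, (i < j)%N ==> (f i < f j)%N]].

Definition basis_mx (C : {vspace V}) : 'M[K]_(k, \dim {:V}) :=
  \matrix_(i, j) coord (vbasis {:V}) j (vbasis C)`_i.

Definition pluecker (C : {vspace V}) (i : 'I_#|pluecker_index|) : K :=
  \det (colsub (enum_val i) (basis_mx C)).

(* The coordinates depend on the basis of C only up to a common nonzero factor,
   so the vanishing of a homogeneous polynomial on them does not. *)
Definition zariski_closed (Z : {vspace V} -> Prop) : Prop :=
  exists F : {mpoly K[#|pluecker_index|]} -> Prop,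
    (forall q, F q -> exists d, q \is d.-homog) /\
    (forall C, Z C <-> \dim C = k /\ forall q, F q -> q.@[pluecker C] = 0).

(* Closure of S in the subspace X of Gr(k, V). *)
Definition closure_in (X S : {vspace V} -> Prop) (C : {vspace V}) : Prop :=
  X C /\
  forall Z, zariski_closed Z -> (forall D, S D -> Z D) -> Z C.

End Grassmannian.

Section Degenerations.
Variables (K : fieldType) (A : falgType K) (n : nat) (e : 'I_n -> A).
Variables (P : fdmod A) (d : 'I_n -> nat).

Definition GrassT (C : {vspace P}) : Prop :=
  \dim C = (\dim {:P} - \sum_i d i)%N /\
  exists2 C' : submodule P, (C' : {vspace P}) = C &
    (C' <= rad_mod P)%VS /\ forall i, dim_vector e (quot_mod C') i = d i.

Definition Aut_u (g : 'End(P)) : Prop :=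
  exists2 f, f \in fdhom P (sub_mod (rad_mod P)) &
    g = (\1 + (incl (rad_mod P) \o f))%VF.

Definition Aut_u_orbit (C D : {vspace P}) : Prop :=
  exists2 g, Aut_u g & D = (g @: C)%VS.

(* M' is a unipotent top-stable degeneration of P / C. *)
Definition unipotent_top_stable_degeneration (C : submodule P) (M' : fdmod A)
    : Prop :=
  exists2 C' : submodule P,
    closure_in (\dim {:P} - \sum_i d i) GrassT (Aut_u_orbit C) C' &
    mod_iso M' (quot_mod C').

(* The integer dim Hom(P, JP/C) - dim Hom(P/C, JP/C). *)
Definition mdim (C : submodule P) : int :=
  let JPC := sub_mod (sub_quot C (rad_mod P)) in
  (\dim (fdhom P JPC))%:Z - (\dim (fdhom (quot_mod C) JPC))%:Z.

End Degenerations.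

(* Main.v *)
From HB Require Import structures.
Require Import Defs.
From mathcomp Require Import all_boot all_order all_algebra all_field.
From mathcomp Require Import boolp mpoly perm.

Set Implicit Arguments.
Unset Strict Implicit.
Unset Printing Implicit Defensive.
Import GRing.Theory.
Local Open Scope ring_scope.

(** The equivalence of the stability of [C] under [Hom(P, JP)] with the orbit
    condition is immediate, and its equivalence with [mdim C = 0] holds because
    [Hom(P/C, JP/C)] is the space of those maps in [Hom(P, JP/C)] that vanish
    on [C], while every map from the projective module [P] to [JP/C] lifts to
    [JP] ([mdim_eq0]).  If [C] is stable, its orbit is a point, which is closed
    because a subspace is determined by its Pluecker coordinates
    ([zariski_closed_point]); so there is no proper degeneration.

    Conversely, the closure of the orbit of [C] contains a fixed point [D] of
    the unipotent group, as in Borel's fixed point theorem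
    ([reachable_fixed_point]).  If [P/C] has no proper degeneration, then
    [P/D] and [P/C] are isomorphic, hence [C] is the image of [D] under an
    automorphism of [P], and stability passes from [D] to [C] ([stable_iso]).

    The fixed point is obtained by successive limits.  By Nakayama's lemma, the
    powers [J^k P] vanish eventually, so that the algebra [Hom(P, JP)], filtered
    by the spaces [Hom(P, J^k P)] ([rad_end]), is nilpotent.  Suppose that [U] is stable under [Hom(P, J^(k+1) P)], and let
    [f] lie in [Hom(P, J^k P)].  Then [f^2] stabilises [U], and the subspaces
    [(1 + t f) U] tend, as [t] goes to infinity, to the explicit subspace
    [U0 + f U], with [U0] the set of the [u] in [U] such that [f u] is in [U]
    ([zariski_closed_lim]).  The limit is stable under [f] and under everything
    in [Hom(P, J^k P)] that stabilised [U] ([reachable_step]).  Running through a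
    basis of [Hom(P, J^k P)], for decreasing [k], leads to a fixed point. *)

(** * Pluecker coordinates of a matrix *)

(** An injective family of indices is an increasing one, reordered. *)
Lemma injective_sort k n (f : 'I_k -> 'I_n) : injective f ->
  exists (g : {ffun 'I_k -> 'I_n}) (s : 'S_k),
    (forall i j : 'I_k, (i < j)%N -> (g i < g j)%N) /\ forall i, f i = g (s i).
Proof.
move=> injf; pose A := [set f i | i : 'I_k].
have cA : k = #|A| by rewrite card_imset // card_ord.
have fA i : f i \in A by apply: imset_f.
pose g := [ffun i : 'I_k => enum_val (cast_ord cA i)].
pose s0 i := cast_ord (esym cA) (enum_rank_in (fA i) (f i)).
have gs i : f i = g (s0 i) by rewrite ffunE cast_ordKV enum_rankK_in.
have injs : injective s0 by move=> i j sij; apply: injf; rewrite !gs sij.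
exists g, (perm injs); split=> [i j lt_ij|i]; last by rewrite permE.
(* The enumeration of a set of ordinals is increasing. *)
have srt : sorted ltn (map val (enum A)).
  apply: (subseq_sorted ltn_trans) (iota_ltn_sorted 0 n).
  by rewrite -val_enum_ord map_subseq // {1}/enum_mem -enumT filter_subseq.
rewrite !ffunE; have szA : size (enum A) = k by rewrite -cardE -cA.
rewrite !(enum_val_nth (f i)) -!(nth_map _ 0%N val) ?szA //=.
by apply: (sorted_ltn_nth ltn_trans) => //; rewrite inE size_map szA.
Qed.

Section Minors.
Variables (K : fieldType) (k n : nat).
Implicit Types B : 'M[K]_(k, n).

Lemma minor_not_inj B (f : 'I_k -> 'I_n) :
  ~ injective f -> \det (colsub f B) = 0.
Proof.
move=> ninj; have [i [j [nij fij]]] : exists i j, i != j /\ f i = f j.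
  apply: contrapT => h; apply: ninj => i j fij; apply/eqP/negP => nij.
  by apply: h; exists i, j; split=> //; apply/negP.
rewrite -det_tr; apply: (determinant_alternate nij) => l.
by rewrite !mxE fij.
Qed.

Lemma minor_perm B (g : 'I_k -> 'I_n) (s : 'S_k) :
  \det (colsub (fun i => g (s i)) B) = \det (colsub g B) * (-1) ^+ s.
Proof.
have -> : colsub (fun i => g (s i)) B = col_perm s (colsub g B).
  by apply/matrixP=> i j; rewrite !mxE.
by rewrite col_permE det_mulmx det_perm odd_permV.
Qed.

(** Minors along increasing families of columns determine all the minors. *)
Lemma minors_proportional B B' (c : K) :
  (forall g : {ffun 'I_k -> 'I_n}, (forall i j : 'I_k, (i < j)%N -> (g i < g j)%N) ->
    \det (colsub g B') = c * \det (colsub g B)) ->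
  forall f : 'I_k -> 'I_n, \det (colsub f B') = c * \det (colsub f B).
Proof.
move=> Hg f; have [injf|ninj] := pselect (injective f); last first.
  by rewrite !minor_not_inj ?mulr0.
have [g [s [incg fgs]]] := injective_sort injf.
have E (X : 'M[K]_(k, n)) : colsub f X = colsub (fun i => g (s i)) X.
  by apply/matrixP=> i j; rewrite !mxE fgs.
by rewrite !E !minor_perm Hg // mulrA.
Qed.

Lemma row_free_minor B : row_free B -> exists g : {ffun 'I_k -> 'I_n},
  (forall i j : 'I_k, (i < j)%N -> (g i < g j)%N) /\ \det (colsub g B) != 0.
Proof.
move=> frB; have fB : row_full B^T by rewrite /row_full mxrank_tr.
pose f := fullrankfun fB.
have [g [s [incg fgs]]] := injective_sort (@fullrankfun_inj _ _ _ _ fB).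
exists g; split=> //.
have : \det (colsub f B) != 0.
  have := fullrowsub_full fB; rewrite row_full_unit unitmxE unitfE.
  by rewrite -det_tr /mxsub; congr (\det _ != 0); apply/matrixP=> i j; rewrite !mxE.
have -> : colsub f B = colsub (fun i => g (s i)) B.
  by apply/matrixP=> i j; rewrite !mxE -fgs.
by rewrite minor_perm mulf_eq0 negb_or => /andP [].
Qed.

(** Cramer's rule: the entries of [adj(S) B], for [S] the submatrix of [B] with
    columns [g], are the minors obtained by replacing one column of [S]. *)
Lemma adj_mul_minor B (g : 'I_k -> 'I_n) i j :
  (\adj (colsub g B) *m B) i j =
  \det (colsub (fun l => if l == i then j else g l) B).
Proof.
rewrite (expand_det_col _ i) !mxE; apply: eq_bigr => l _.
rewrite !mxE eqxx mulrC; congr (_ * _); rewrite /cofactor; congr (_ * \det _).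
by apply/matrixP=> a b; rewrite !mxE eq_sym (negPf (neq_lift _ _)).
Qed.

(** If the maximal minors of [B'] are a common multiple of those of [B], and the
    rows of [B'] are independent, then they lie in the row space of [B]. *)
Lemma minors_submx B B' (c : K) : row_free B' ->
  (forall f : 'I_k -> 'I_n, \det (colsub f B') = c * \det (colsub f B)) ->
  (B' <= B)%MS.
Proof.
move=> /row_free_minor [g [_ nz]] H.
have E : \adj (colsub g B') *m B' = c *: (\adj (colsub g B) *m B).
  by apply/matrixP=> i j; rewrite [RHS]mxE !adj_mul_minor H.
have /(canRL (scalerK nz)) -> : \det (colsub g B') *: B' =
    (c *: (colsub g B' *m \adj (colsub g B))) *m B.
  by rewrite -mul_scalar_mx -mul_mx_adj -mulmxA E -scalemxAl -scalemxAr mulmxA.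
by rewrite scalemx_sub // submxMl.
Qed.
End Minors.

(** * Subspaces in coordinates *)

Section Coord.
Variables (K : fieldType) (V : vectType K).

(** The rows are the coordinates of the vectors of the family [b]. *)
Definition coord_mx k (b : k.-tuple V) : 'M[K]_(k, \dim {:V}) :=
  \matrix_(i, j) coord (vbasis {:V}) j b`_i.

Lemma coord_mx_sub k l (b : k.-tuple V) (b' : l.-tuple V) :
  (coord_mx b <= coord_mx b')%MS <-> (<<b>> <= <<b'>>)%VS.
Proof.
have fb := basis_free (vbasisP {:V}).
split=> [/submxP [M E]|sub].
  apply/span_subvP=> v /(nthP 0) [i]; rewrite size_tuple => ltik <-.
  have -> : b`_i = \sum_j M (Ordinal ltik) j *: b'`_j.
    rewrite (coord_vbasis (memvf b`_i)) [RHS](coord_vbasis (memvf _)).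
    apply: eq_bigr => h _; congr (_ *: _).
    have /matrixP/(_ (Ordinal ltik) h) := E; rewrite !mxE /= => ->.
    by rewrite linear_sum; apply: eq_bigr => j _; rewrite linearZ !mxE.
  by apply: memv_suml => j _; rewrite memvZ // memv_span // mem_nth ?size_tuple.
apply/submxP; exists (\matrix_(i, j) coord b' j b`_i).
apply/matrixP=> i h; rewrite !mxE.
have bi : b`_i \in <<b'>>%VS.
  by apply: (subvP sub); rewrite memv_span // mem_nth ?size_tuple.
rewrite [in LHS](coord_span bi) linear_sum; apply: eq_bigr => j _.
by rewrite linearZ !mxE.
Qed.

Lemma basis_mx_coord k (C : {vspace V}) (e : \dim C = k) :
  basis_mx k C = coord_mx (tcast e (vbasis C)).
Proof. by subst k; apply/matrixP=> i j; rewrite !mxE. Qed.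

Lemma span_tcast k (C : {vspace V}) (e : \dim C = k) :
  <<tcast e (vbasis C)>>%VS = C.
Proof. by subst k; rewrite tcast_id (span_basis (vbasisP C)). Qed.

(** The maximal minors of a family in the span of [b'] are a common multiple of
    those of [b']; a change of basis thus rescales the Pluecker coordinates. *)
Lemma minors_scale k (b b' : k.-tuple V) : (<<b>> <= <<b'>>)%VS ->
  exists c, forall f, \det (colsub f (coord_mx b)) = c * \det (colsub f (coord_mx b')).
Proof.
move/coord_mx_sub/submxP => [M ->]; exists (\det M) => f.
rewrite -det_mulmx; congr (\det _); apply/matrixP=> i j; rewrite !mxE.
by apply: eq_bigr=> l _; rewrite !mxE.
Qed.

Lemma coord_mx_free k (b : k.-tuple V) : free b -> row_free (coord_mx b).
Proof.
move=> fb; apply/row_freeP; exists (\matrix_(h, j) coord b j (vbasis {:V})`_h).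
apply/matrixP=> i j; rewrite !mxE -(coord_free i j fb).
rewrite [in RHS](coord_vbasis (memvf b`_i)) linear_sum.
by apply: eq_bigr => h _; rewrite linearZ !mxE.
Qed.
End Coord.

(** * Closed subsets of the Grassmannian *)

Lemma meval_homogZ (R : comNzRingType) m (q : {mpoly R[m]}) d (v w : 'I_m -> R) c :
  q \is d.-homog -> (forall i, v i = c * w i) -> q.@[v] = c ^+ d * q.@[w].
Proof.
move=> /dhomogP hq vE; rewrite !mevalE big_distrr /=.
apply: eq_big_seq => mm /hq <-; rewrite mulrCA; congr (_ * _).
under eq_bigr => i _ do rewrite vE exprMn.
by rewrite big_split /= mdegE prodrXr.
Qed.

(** A polynomial over an algebraically closed field that vanishes away from
    zero is zero: otherwise ['X * p + 1] would be a nonconstant polynomial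
    without roots. *)
Lemma poly_root_neq0 (K : closedFieldType) (p : {poly K}) :
  (forall s, s != 0 -> p.[s] = 0) -> p = 0.
Proof.
move=> p0; apply/eqP/negPn/negP => nzp.
have sz : size (p * 'X + 1%:P) != 1%N.
  by rewrite size_MXaddC (negPf nzp) /= eqSS size_poly_eq0.
have [s /rootP] := closed_rootP _ sz.
rewrite !hornerE; have [->|/p0 ->] := eqVneq s 0; rewrite ?mulr0 ?mul0r add0r.
  by move/eqP; rewrite oner_eq0.
by move/eqP; rewrite oner_eq0.
Qed.

Section Closed.
Variables (K : closedFieldType) (V : vectType K) (k : nat).

(** As [s] tends to zero, the span of the vectors [x + s y], for [(x, y)] in the
    list [w], tends to the span of the vectors [x], if these are linearly
    independent. *)
Lemma zariski_closed_limit (Z : {vspace V} -> Prop) (w : seq (V * V)) :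
    zariski_closed k Z -> size w = k ->
    (forall s, s != 0 -> Z <<[seq (p.1 + s *: p.2)%R | p <- w]>>%VS) ->
  free [seq p.1 | p <- w] -> Z <<[seq p.1 | p <- w]>>%VS.
Proof.
move=> [F [Fhom ZF]] szw Zs fw.
have szm (f : V * V -> V) : size [seq f p | p <- w] == k by rewrite size_map szw.
pose tp f := Tuple (szm f); pose B := coord_mx (tp fst); pose B' := coord_mx (tp snd).
have dimw : \dim <<[seq p.1 | p <- w]>> = k by move: fw => /eqP ->; rewrite size_map.
apply/ZF; split=> // q Fq; have [d hq] := Fhom q Fq.
(* The minors of the curve are polynomials in [s]; substituted into an equation
   [q] of [Z], they yield a polynomial [pq] that vanishes for [s != 0], hence
   also at [s = 0]. *)
pose minor (s : K) (i : 'I_#|pluecker_index V k|) :=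
  \det (colsub (enum_val i) (B + s *: B')).
pose pm (i : 'I_#|pluecker_index V k|) : {poly K} :=
  \det (colsub (enum_val i) (map_mx polyC B + 'X *: map_mx polyC B')).
have pmE s i : (pm i).[s] = minor s i.
  rewrite /pm -[LHS]/(horner_eval s _) -det_map_mx; congr (\det _).
  by apply/matrixP=> a b; rewrite !mxE /= /horner_eval hornerD hornerM hornerX !hornerC.
pose pq := \sum_(m <- msupp q) (q@_m)%:P * \prod_i pm i ^+ m i.
have pqE s : pq.[s] = q.@[minor s].
  rewrite mevalE horner_sum; apply: eq_bigr => m _.
  rewrite hornerM hornerC horner_prod; congr (_ * _); apply: eq_bigr => i _.
  by rewrite horner_exp pmE.
have minorE s i :
    minor s i = \det (colsub (enum_val i) (coord_mx (tp (fun p => p.1 + s *: p.2)))).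
  congr (\det _); apply/matrixP=> a b; rewrite !mxE /=.
  by rewrite !(nth_map (0, 0)) ?szw // linearD linearZ.
have pq0 : pq = 0.
  apply: poly_root_neq0 => s /Zs /ZF [dims /(_ _ Fq) q0]; rewrite pqE.
  have [c cE] : exists c, forall f,
      \det (colsub f (coord_mx (tp (fun p => p.1 + s *: p.2)))) =
      c * \det (colsub f (basis_mx k <<tp (fun p => p.1 + s *: p.2)%R>>)).
    by rewrite (basis_mx_coord dims); apply: minors_scale; rewrite span_tcast.
  rewrite (@meval_homogZ _ _ q d _ (pluecker <<tp (fun p => p.1 + s *: p.2)%R>>%VS) c) //.
    by rewrite q0 mulr0.
  by move=> i; rewrite minorE cE.
have [c cE] : exists c, forall f, \det (colsub f (basis_mx k <<tp fst>>)) =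
      c * \det (colsub f (coord_mx (tp fst))).
  by rewrite (basis_mx_coord dimw); apply: minors_scale; rewrite span_tcast.
rewrite (@meval_homogZ _ _ q d _ (minor 0) c) //.
  by rewrite -pqE pq0 horner0 mulr0.
by move=> i; rewrite /pluecker cE /minor scale0r addr0.
Qed.

(** The Pluecker map is injective, so that points of the Grassmannian are
    closed. *)
Lemma zariski_closed_point (C : {vspace V}) : \dim C = k ->
  zariski_closed k (fun D => D = C).
Proof.
move=> dimC.
(* All the homogeneous equations satisfied by [C]; only the linear equations
   [p_i(C) X_j - p_j(C) X_i] are used. *)
exists (fun q => (exists d, q \is d.-homog) /\ q.@[pluecker C] = 0).
split=> [q [] // | D]; split=> [-> | [dimD qD]]; first by split=> // q [].
have freeB (E : {vspace V}) : \dim E = k -> row_free (basis_mx k E).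
  move=> dimE; rewrite (basis_mx_coord dimE) coord_mx_free //.
  have := basis_free (vbasisP E); case: _ / dimE; by rewrite tcast_id.
have [g [incg nzg]] := row_free_minor (freeB C dimC).
have idx (f : {ffun 'I_k -> 'I_(\dim {:V})}) :
    (forall i j : 'I_k, (i < j)%N -> (f i < f j)%N) -> f \in pluecker_index V k.
  by move=> incf; rewrite inE; apply/forallP=> i; apply/forallP=> j; apply/implyP/incf.
pose rk f (Hf : f \in pluecker_index V k) := enum_rank_in Hf f.
have rkE E f Hf : pluecker E (@rk f Hf) = \det (colsub f (basis_mx k E)).
  by rewrite /pluecker enum_rankK_in.
pose i0 := rk _ (idx g incg).
have Hminors : forall f : 'I_k -> 'I_(\dim {:V}), \det (colsub f (basis_mx k D)) =
    (pluecker D i0 / pluecker C i0) * \det (colsub f (basis_mx k C)).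
  apply: minors_proportional => f incf; pose j := rk _ (idx f incf).
  rewrite -(rkE D _ (idx f incf)) -(rkE C _ (idx f incf)) -/j.
  have : ((pluecker C i0) *: 'X_j - (pluecker C j) *: 'X_i0).@[pluecker D] = 0.
    apply: qD; split; last by rewrite mevalB !mevalZ !mevalXU mulrC subrr.
    by exists 1%N; rewrite rpredB // rpredZ // dhomogX /= mdeg1.
  rewrite mevalB !mevalZ !mevalXU => /eqP; rewrite subr_eq0 => /eqP E.
  have nz : pluecker C i0 != 0 by rewrite rkE.
  by apply: (mulfI nz); rewrite E mulrA [_ * (_ / _)]mulrCA divff // mulr1 mulrC.
have := minors_submx (freeB D dimD) Hminors.
rewrite (basis_mx_coord dimC) (basis_mx_coord dimD) => /coord_mx_sub.
by rewrite !span_tcast => sub; apply/eqP; rewrite eqEdim sub dimC dimD leqnn.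
Qed.
End Closed.

(** * Module homomorphisms *)

Section Homs.
Variables (K : fieldType) (A : falgType K).
Implicit Types M N P : fdmod A.

Lemma homE M N (f : 'Hom(M, N)) :
  f \in fdhom M N <-> forall a v, f (act M a v) = act N a (f v).
Proof.
rewrite fdhomP; split=> [h a v|h a]; first by rewrite -!comp_lfunE h.
by apply/lfunP=> v; rewrite !comp_lfunE.
Qed.

Lemma hom_comp M N P (g : 'Hom(N, P)) (f : 'Hom(M, N)) :
  g \in fdhom N P -> f \in fdhom M N -> (g \o f)%VF \in fdhom M P.
Proof. by rewrite !homE => hg hf a v; rewrite !comp_lfunE hf hg. Qed.

Lemma hom_id M : \1%VF \in fdhom M M.
Proof. by apply/homE=> a v; rewrite !id_lfunE. Qed.

Lemma hom_inv M N (f : 'Hom(M, N)) : f \in fdhom M N -> lker f = 0%VS ->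
  limg f = fullv -> (f^-1)%VF \in fdhom N M.
Proof.
move=> /homE hf /eqP/lker0P injf fullf; apply/homE=> a v.
have fK : cancel (f^-1)%VF f by move=> w; rewrite limg_lfunVK // fullf memvf.
by apply: injf; rewrite hf !fK.
Qed.

Lemma mod_iso_refl M : mod_iso M M.
Proof.
exists \1%VF; split; first exact: hom_id.
  by apply/eqP/lker0P => u v; rewrite !id_lfunE.
by rewrite lim1g.
Qed.

Lemma mod_iso_sym M N : mod_iso M N -> mod_iso N M.
Proof.
move=> [f [hf kf ff]]; exists (f^-1)%VF; split; first exact: hom_inv.
  apply/eqP/lker0P => u v /(congr1 f).
  by rewrite !limg_lfunVK // ff memvf.
apply/vspaceP=> v; rewrite memvf; apply/memv_imgP; exists (f v); rewrite ?memvf //.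
by rewrite lker0_lfunK // kf.
Qed.

Lemma mod_iso_trans M N P : mod_iso M N -> mod_iso N P -> mod_iso M P.
Proof.
move=> [f [hf /eqP/lker0P injf ff]] [g [hg /eqP/lker0P injg fg]].
exists (g \o f)%VF; split.
- exact: hom_comp.
- by apply/eqP/lker0P => u v; rewrite !comp_lfunE => /injg/injf.
- by rewrite limg_comp ff.
Qed.

Lemma submodule_act M (U : submodule M) a v : v \in U -> act M a v \in U.
Proof. by move=> Uv; apply: (subvP (sm_stable U a)); apply: memv_img. Qed.

Lemma submodule_inj M (U W : submodule M) : U = W :> {vspace M} -> U = W.
Proof.
case: U W => [U HU] [W HW] /= E; subst W; congr Submodule; exact: Prop_irrelevance.
Qed.

(** Homomorphisms into a submodule are homomorphisms into the ambient module
    with image in the submodule. *)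
Lemma hom_incl M N (U : submodule N) (f : 'Hom(M, sub_mod U)) :
  f \in fdhom M (sub_mod U) ->
  (incl U \o f)%VF \in fdhom M N /\ (limg (incl U \o f)%VF <= U)%VS.
Proof.
move=> hf; split; first by apply: hom_comp => //; apply: incl_hom.
by rewrite limg_comp -[X in (_ <= X)%VS]limg_incl limgS ?subvf.
Qed.

Lemma hom_corestrict M N (U : submodule N) (f : 'Hom(M, N)) :
  f \in fdhom M N -> (limg f <= U)%VS ->
  exists2 g, g \in fdhom M (sub_mod U) & f = (incl U \o g)%VF.
Proof.
move=> /homE hf fU; pose g : 'Hom(M, sub_mod U) := (linfun (vsproj U) \o f)%VF.
have gE v : vsval (g v) = f v.
  by rewrite comp_lfunE lfunE /= vsprojK // (subvP fU) // memv_img ?memvf.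
exists g; last by apply/lfunP=> v; rewrite comp_lfunE inclE gE.
by apply/homE=> a v; apply: val_inj; rewrite /= gE hf sub_actE gE.
Qed.

Lemma quot_proj_eq0 M (C : submodule M) v : (quot_proj C v == 0) = (v \in C).
Proof. by rewrite -memv_ker lker_quot_proj. Qed.

(** A homomorphism that vanishes on [C] factors through [M/C]. *)
Lemma hom_quot_factor M N (C : submodule M) (g : 'Hom(M, N)) :
  g \in fdhom M N -> (forall c, c \in C -> g c = 0) ->
  exists2 h, h \in fdhom (quot_mod C) N & g = (h \o quot_proj C)%VF.
Proof.
move=> /homE hg gC; pose h : 'Hom(quot_mod C, N) := (g \o linfun vsval)%VF.
have hE v : h (quot_proj C v) = g v.
  rewrite /h comp_lfunE lfunE /=; apply/eqP; rewrite -subr_eq0 -linearB.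
  apply/eqP/gC; rewrite -quot_proj_eq0 linearB /=.
  by rewrite [quot_proj C _]quot_funK subrr.
exists h; last by apply/lfunP=> v; rewrite comp_lfunE hE.
apply/homE=> a x; have : x \in limg (quot_proj C) by rewrite limg_quot_proj memvf.
have /homE hp := quot_proj_hom C.
by move=> /memv_imgP [v _ ->]; rewrite -hp !hE hg.
Qed.

End Homs.

(** * Nakayama's lemma and the radical filtration *)

Section Nakayama.
Variables (K : fieldType) (A : falgType K).
Implicit Types M N : fdmod A.

Lemma rad_sub_stable M (U : submodule M) a :
  (act M a @: (incl U @: rad_vs (sub_mod U)) <= incl U @: rad_vs (sub_mod U))%VS.
Proof.
have /fdhomP/(_ a) H := incl_hom U.
by rewrite -limg_comp -H limg_comp limgS // rad_stable.
Qed.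

(** The submodule [J U] of [M], for a submodule [U] of [M]. *)
Definition rad_sub M (U : submodule M) : submodule M :=
  Submodule (@rad_sub_stable M U).

Lemma rad_sub_act M (U : submodule M) a v :
  a \in jacobson_radical A -> v \in U -> act M a v \in rad_sub U.
Proof.
move=> Ja Uv; have -> : v = incl U (vsproj U v) by rewrite inclE vsprojK.
have /homE <- := incl_hom U; by rewrite memv_img // mem_rad_vs.
Qed.

Lemma rad_sub_min M (U : submodule M) (W : {vspace M}) :
  (forall a v, a \in jacobson_radical A -> v \in U -> act M a v \in W) ->
  (rad_sub U <= W)%VS.
Proof.
move=> H; apply/subvP=> _ /memv_imgP [v Jv ->]; rewrite memv_preim.
apply: subvP v Jv; apply: rad_vs_min => a v Ja; rewrite -memv_preim.
by have /homE -> := incl_hom U; rewrite H // inclE subvsP.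
Qed.

Lemma rad_sub_sub M (U : submodule M) : (rad_sub U <= U)%VS.
Proof. by apply: rad_sub_min => a v _; apply: submodule_act. Qed.

(** The linear map [a |-> a v] from [A] to [M]. *)
Definition act_at M (v : M) (a : A) : M := act M a v.
Fact act_at_linear M (v : M) : linear (act_at v).
Proof. exact: act_linear_l. Qed.
HB.instance Definition _ M (v : M) :=
  GRing.isLinear.Build K A M _ (act_at v) (act_at_linear v).

(** A proper [W] lies in a maximal proper submodule [X]; for [v] outside [X],
    the elements [a] of [A] with [a v] in [X] form a maximal left ideal, so that
    [J v] is contained in [X]. Hence [X] contains [W + JM]. *)
Lemma nakayama M (W : submodule M) :
  (W + rad_mod M)%VS = fullv -> W = fullv :> {vspace M}.
Proof.
move=> WJ; apply: contrapT => /eqP Wproper.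
pose Q m := `[< exists X : submodule M,
  [/\ (W <= X)%VS, X != fullv :> {vspace M} & \dim X = m] >].
have exQ : exists m, Q m by exists (\dim W); apply/asboolP; exists W.
have bndQ m : Q m -> (m <= \dim {:M})%N.
  by move=> /asboolP [X [_ _ <-]]; rewrite dimvS ?subvf.
case: (ex_maxnP exQ bndQ) => m /asboolP [X [WX Xproper dimX]] maxX.
suff JX : (rad_mod M <= X)%VS.
  move: Xproper; rewrite eqEsubv subvf /= -WJ subv_add WX JX //.
have maximalX (Y : submodule M) v : (X <= Y)%VS -> v \in Y -> v \notin X ->
    Y = fullv :> {vspace M}.
  move=> XY Yv Xv; apply/eqP; apply/negPn/negP => Yproper.
  have : (\dim Y <= m)%N.
    by apply: maxX; apply/asboolP; exists Y; split=> //; apply: subv_trans XY.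
  rewrite -dimX => dimY; have /eqP E : (X : {vspace M}) == Y by rewrite eqEdim XY.
  by rewrite E Yv in Xv.
apply: rad_vs_min => a v Ja; have [Xv|Xv] := boolP (v \in X); first exact: submodule_act.
pose ev : 'Hom(regular_mod A, M) := linfun (act_at v).
have evE b : ev b = act M b v by rewrite lfunE.
have evM b c : ev (b * c) = act M b (ev c) by rewrite !evE actM comp_lfunE.
have regE b c : act (regular_mod A) b c = b * c by rewrite /= lfunE.
have I_stable b : (act (regular_mod A) b @: (ev @^-1: X) <= ev @^-1: X)%VS.
  apply/subvP=> _ /memv_imgP [c Xc ->]; rewrite regE -memv_preim evM.
  by apply: submodule_act; rewrite memv_preim.
suff maxI : maximal_left_ideal (Submodule I_stable).
  by have := (jacobson_radicalP a).1 Ja _ maxI; rewrite /= -memv_preim evE.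
split=> [/= I1|I' /= II'].
  by move: (memvf (1 : A)); rewrite -I1 -memv_preim evE act1 id_lfunE (negPf Xv).
have [I'I|/subvPn [b I'b]] := boolP (I' <= ev @^-1: X)%VS.
  by left; apply/eqP; rewrite eqEsubv I'I II'.
rewrite -memv_preim => Xb; right.
have Y_stable c : (act M c @: (X + ev @: I') <= X + ev @: I')%VS.
  rewrite limgD addvS ?sm_stable //.
  apply/subvP=> _ /memv_imgP [_ /memv_imgP [z I'z ->] ->].
  rewrite -evM memv_img //; by have := submodule_act c I'z; rewrite regE.
have Yfull := maximalX (Submodule Y_stable) (ev b) (addvSl _ _)
  (subvP (addvSr _ _) _ (memv_img _ I'b)) Xb.
have : v \in (X + ev @: I')%VS.
  by rewrite -[(X + _)%VS]/(sm_vspace (Submodule Y_stable)) Yfull memvf.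
move=> /memv_addP [x Xx [_ /memv_imgP [c I'c ->]] vE].
have I'1 : 1 \in (I' : {vspace A}).
  have -> : 1 = (1 - c) + c by rewrite subrK.
  rewrite memvD // (subvP II') // -memv_preim linearB /= evE act1 id_lfunE [X in X - _]vE.
  by rewrite addrK.
apply/vspaceP=> c0; rewrite memvf -[c0]mulr1.
by have := @submodule_act K A (regular_mod A) I' c0 1 I'1; rewrite regE.
Qed.

(** The submodule [J^(k+1) M]; the numbering starts from [JM]. *)
Fixpoint radpow M k : submodule M :=
  if k is k'.+1 then rad_sub (radpow M k') else rad_mod M.

Lemma radpow_eq0 M : exists k, radpow M k = 0%VS :> {vspace M}.
Proof.
have step (U : submodule M) : (\dim (rad_sub U) < \dim U)%N \/
    U = 0%VS :> {vspace M}.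
  have [U0|U0] := eqVneq (U : {vspace M}) 0%VS; [by right | left].
  rewrite ltn_neqAle dimvS ?rad_sub_sub // andbT; apply/negP => dimE.
  move/negP: U0; apply; rewrite -dimv_eq0.
  have /eqP E : (rad_sub U : {vspace M}) == U.
    by rewrite eqEdim rad_sub_sub (eqP dimE) leqnn.
  have J_full : rad_vs (sub_mod U) = fullv.
    apply/vspaceP=> x; rewrite memvf.
    have : vsval x \in (rad_sub U : {vspace M}) by rewrite E subvsP.
    by move=> /memv_imgP [y Jy]; rewrite inclE => /val_inj ->.
  have zero_stable a : (act (sub_mod U) a @: 0%VS <= 0%VS)%VS by rewrite limg0 subvv.
  have := @nakayama _ (Submodule zero_stable).
  rewrite /= add0v => /(_ J_full) F.
  by rewrite -E /= J_full -F limg0 dimv0.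
suff H m : forall k, (\dim (radpow M k) <= m)%N ->
    exists k, radpow M k = 0%VS :> {vspace M}.
  exact: (H _ 0%N (leqnn _)).
elim: m => [|m IHm] k le_km.
  by exists k; apply/eqP; rewrite -dimv_eq0 -leqn0.
case: (step (radpow M k)) => [lt|]; last by exists k.
by apply: (IHm k.+1); rewrite -ltnS; apply: leq_trans le_km.
Qed.

Lemma hom_rad_sub M N (f : 'Hom(M, N)) (U : submodule M) (W : submodule N) :
  f \in fdhom M N -> (f @: U <= W)%VS -> (f @: rad_sub U <= rad_sub W)%VS.
Proof.
move=> /homE hf fUW; apply/subvP=> _ /memv_imgP [v Jv ->]; rewrite memv_preim.
apply: subvP v Jv; apply: rad_sub_min => a v Ja Uv.
by rewrite -memv_preim hf rad_sub_act // (subvP fUW) // memv_img.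
Qed.

Lemma hom_rad M N (f : 'Hom(M, N)) (W : submodule N) :
  f \in fdhom M N -> (limg f <= W)%VS -> (f @: rad_mod M <= rad_sub W)%VS.
Proof.
move=> /homE hf fW; apply/subvP=> _ /memv_imgP [v Jv ->]; rewrite memv_preim.
apply: subvP v Jv; apply: rad_vs_min => a v Ja.
by rewrite -memv_preim hf rad_sub_act // (subvP fW) // memv_img ?memvf.
Qed.

Lemma hom_rad_rad M N (f : 'Hom(M, N)) :
  f \in fdhom M N -> (f @: rad_mod M <= rad_mod N)%VS.
Proof.
move=> /homE hf; apply/subvP=> _ /memv_imgP [v Jv ->]; rewrite memv_preim.
apply: subvP v Jv; apply: rad_vs_min => a v Ja.
by rewrite -memv_preim hf mem_rad_vs.
Qed.

Lemma radpow_sub M k : (radpow M k <= rad_mod M)%VS.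
Proof. by elim: k => [|k IHk] //=; apply: subv_trans (rad_sub_sub _) IHk. Qed.
End Nakayama.

(** * The nilpotent algebra Hom(P, JP) and its unipotent group *)

Section RadicalEndomorphisms.
Variables (K : fieldType) (A : falgType K) (P : fdmod A).

(** Membership in [Hom(P, J^(k+1) P)], viewed inside [End(P)]. *)
Definition rad_end k (f : 'End(P)) : Prop :=
  f \in fdhom P P /\ (limg f <= radpow P k)%VS.

Lemma rad_end0 k : rad_end k 0.
Proof. by split; rewrite ?mem0v // lim0g sub0v. Qed.

Lemma rad_endL k (c : K) f g : rad_end k f -> rad_end k g -> rad_end k (c *: f + g).
Proof.
move=> [hf fk] [hg gk]; split; first by rewrite memvD ?memvZ.
apply/subvP=> _ /memv_imgP [v _ ->]; rewrite add_lfunE scale_lfunE.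
by rewrite memvD ?memvZ //;
  [apply: (subvP fk) | apply: (subvP gk)]; rewrite memv_img ?memvf.
Qed.

Lemma rad_endD k f g : rad_end k f -> rad_end k g -> rad_end k (f + g).
Proof. by rewrite -[f in f + g]scale1r; apply: rad_endL. Qed.

Lemma rad_endZ k c f : rad_end k f -> rad_end k (c *: f).
Proof. by move=> hf; rewrite -[_ *: _]addr0; apply: rad_endL => //; apply: rad_end0. Qed.

Lemma rad_end_le k f : rad_end k f -> rad_end 0 f.
Proof. by move=> [hf fk]; split=> //; apply: subv_trans fk (radpow_sub _ _). Qed.

Lemma rad_end_pred k f : rad_end k.+1 f -> rad_end k f.
Proof. by move=> [hf fk]; split=> //; apply: subv_trans fk (rad_sub_sub _). Qed.

Lemma rad_end_mulr k f g : rad_end k f -> rad_end 0 g -> rad_end k.+1 (f \o g)%VF.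
Proof.
move=> [hf fk] [hg g0]; split; first exact: hom_comp.
rewrite limg_comp; apply: subv_trans (limgS f g0) _; exact: hom_rad.
Qed.

Lemma rad_end_radpow k f : rad_end 0 f -> (f @: radpow P k <= radpow P k.+1)%VS.
Proof.
move=> [hf f0]; elim: k => [|k IHk]; first exact: hom_rad.
exact: hom_rad_sub.
Qed.

Lemma rad_end_mull k f g : rad_end 0 f -> rad_end k g -> rad_end k.+1 (f \o g)%VF.
Proof.
move=> f0 [hg gk]; split; first by apply: hom_comp => //; case: f0.
by rewrite limg_comp; apply: subv_trans (limgS f gk) _; apply: rad_end_radpow.
Qed.

Lemma rad_end_nilpotent : exists m, forall f, rad_end m f -> f = 0.
Proof.
have [m Rm] := radpow_eq0 P; exists m => f [_]; rewrite Rm subv0 => /eqP f0.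
apply/lfunP=> v; rewrite zero_lfunE; apply/eqP.
by rewrite -memv0 -f0 memv_img ?memvf.
Qed.

Lemma rad_end_span k : exists l : seq 'End(P),
  (forall f, f \in l -> rad_end k f) /\ (forall f, rad_end k f -> f \in <<l>>%VS).
Proof.
pose U := vspace_of (@rad_end0 k) (@rad_endL k); exists (vbasis U); split=> f.
  by move=> /vbasis_mem /vspace_ofP.
by move=> Hf; rewrite (span_basis (vbasisP U)); apply/vspace_ofP.
Qed.

Lemma rad_end_unipotent_inj f : rad_end 0 f -> lker (\1 + f)%VF = 0%VS.
Proof.
move=> f0; apply/eqP; rewrite -subv0; apply/subvP=> x.
rewrite memv_ker add_lfunE id_lfunE addr_eq0 => /eqP xE.
have xk k : x \in radpow P k.
  elim: k => [|k IHk].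
    by rewrite xE memvN; case: f0 => _ f0; rewrite (subvP f0) // memv_img ?memvf.
  by rewrite xE memvN (subvP (rad_end_radpow k f0)) // memv_img.
by have [m Rm] := radpow_eq0 P; rewrite -Rm.
Qed.

Lemma Aut_uE g : Aut_u g <-> exists2 f, rad_end 0 f & g = (\1 + f)%VF.
Proof.
split=> [[f hf ->]|[f [hf f0] ->]].
  by have := hom_incl hf; exists (incl (rad_mod P) \o f)%VF.
by have [f' hf' ->] := hom_corestrict hf f0; exists f'.
Qed.

Lemma Aut_u_comp g f : Aut_u g -> rad_end 0 f -> Aut_u (g \o (\1 + f))%VF.
Proof.
move=> /Aut_uE [h h0 ->] f0; apply/Aut_uE; exists (h + f + (h \o f))%VF.
  by apply: rad_endD; [exact: rad_endD | apply: rad_end_le (rad_end_mulr h0 f0)].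
apply/lfunP=> v; rewrite !(comp_lfunE, add_lfunE, id_lfunE) linearD /= -!addrA.
by congr (_ + _); rewrite addrCA.
Qed.

Lemma Aut_u_inj (g : 'End(P)) : Aut_u g -> lker g == 0%VS.
Proof. by move=> /Aut_uE [f f0 ->]; rewrite rad_end_unipotent_inj. Qed.
End RadicalEndomorphisms.

(** * Limits along one-parameter curves *)

Section Limit.
Variables (K : fieldType) (V : vectType K).
Implicit Types (U D : {vspace V}) (f g : 'End(V)).

(** The set [U0] of the [u] in [U] such that [f u] is in [U]. *)
Definition lim_core f U : {vspace V} := (U :&: f @^-1: U)%VS.
(** The limit of the subspaces [(1 + t f) U] as [t] goes to infinity, when [U]
    is stable under [f^2] and [f] is nilpotent. *)
Definition lim_vs f U : {vspace V} := (lim_core f U + f @: U)%VS.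

Lemma lim_coreP f U v : reflect (v \in U /\ f v \in U) (v \in lim_core f U).
Proof. by rewrite memv_cap -memv_preim; apply: andP. Qed.

Lemma lim_core_stable f U : (f @: (f @: U) <= U)%VS ->
  (f @: lim_core f U <= lim_core f U)%VS.
Proof.
move=> ffU; apply/subvP=> _ /memv_imgP [v /lim_coreP [Uv Ufv] ->].
by apply/lim_coreP; split=> //; apply: (subvP ffU); rewrite !memv_img.
Qed.

Lemma dim_lim_vs f U : (f @: (f @: U) <= U)%VS -> \dim (lim_vs f U) = \dim U.
Proof.
move=> ffU; set U0 := lim_core f U.
have capE : (U0 :&: f @: U)%VS = (f @: U0)%VS.
  apply/vspaceP=> v; rewrite memv_cap; apply/andP/idP.
    move=> [/lim_coreP [Uv _] /memv_imgP [u Uu vE]]; rewrite vE memv_img //.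
    by apply/lim_coreP; rewrite -vE.
  move=> fv; split; first exact: (subvP (lim_core_stable ffU)).
  exact: subvP (limgS f (capvSl _ _)) _ fv.
have kerE : (U0 :&: lker f)%VS = (U :&: lker f)%VS.
  apply/vspaceP=> v; rewrite !memv_cap -memv_preim memv_ker.
  by case: eqP => [->|_]; rewrite ?andbF // mem0v andbT.
have := dimv_sum_cap U0 (f @: U)%VS; rewrite capE -/(lim_vs f U).
rewrite -(limg_ker_dim f U0) kerE addnAC => /addIn ->.
exact: limg_ker_dim.
Qed.

Lemma limgZ (c : K) f U : c != 0 -> ((c *: f) @: U)%VS = (f @: U)%VS.
Proof.
move=> nzc; apply/vspaceP=> v; apply/memv_imgP/memv_imgP => [] [u Uu ->].
  by exists (c *: u); rewrite ?memvZ // scale_lfunE linearZ.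
exists (c^-1 *: u); first by rewrite memvZ.
by rewrite scale_lfunE linearZ scalerA divff ?scale1r.
Qed.
End Limit.

(** The limit of the translates [g (1 + t f) U] in a closed set is taken in the
    basis formed of a basis of [U0] and of the vectors [s y + f y], with
    [s = 1/t] and [y] in a basis of a complement of [U0] in [U]. *)
Lemma zariski_closed_lim (K : closedFieldType) (V : vectType K) k
    (Z : {vspace V} -> Prop) (f g : 'End(V)) (U : {vspace V}) :
    zariski_closed k Z -> \dim U = k -> (f @: (f @: U) <= U)%VS ->
    lker g == 0%VS -> (forall t, lker (\1 + t *: f)%VF == 0%VS) ->
    (forall t, Z ((g \o (\1 + t *: f)) @: U)%VS) ->
  Z (g @: lim_vs f U)%VS.
Proof.
move=> closedZ dimU ffU injg injf ZU.
set U0 := lim_core f U; pose D := (U :\: U0)%VS.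
have sub0 : (U0 <= U)%VS by apply: capvSl.
have UE : U = (U0 + D)%VS by rewrite addvC addv_diff (addv_idPl sub0).
pose w := [seq (g x, 0) | x <- vbasis U0] ++ [seq (g (f y), g y) | y <- vbasis D].
have szw : size w = k.
  rewrite size_cat !size_map !size_tuple -dimU -(dimv_cap_compl U U0).
  by rewrite (capv_idPr sub0).
have spanE (h : V * V -> V) (h1 h2 : 'End(V)) :
    (forall x, h (g x, 0) = h1 x) -> (forall y, h (g (f y), g y) = h2 y) ->
    <<[seq h p | p <- w]>>%VS = (h1 @: U0 + h2 @: D)%VS.
  move=> E1 E2; rewrite map_cat -!map_comp span_cat.
  rewrite -[in RHS](span_basis (vbasisP U0)) -[in RHS](span_basis (vbasisP D)).
  by rewrite !limg_span; congr (<<_>> + <<_>>)%VS; apply: eq_map.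
have limE : <<[seq p.1 | p <- w]>>%VS = (g @: lim_vs f U)%VS.
  rewrite (spanE _ g (g \o f)%VF) //; last by move=> y; rewrite comp_lfunE.
  rewrite limg_comp -limgD; congr (g @: _)%VS.
  have fUE : (f @: U = f @: U0 + f @: D)%VS by rewrite {1}UE limgD.
  rewrite /lim_vs fUE addvA -/U0.
  by rewrite (addv_idPl (lim_core_stable ffU)).
rewrite -limE; apply: (zariski_closed_limit closedZ szw) => [s nzs|]; last first.
  rewrite /free limE limg_dim_eq ?dim_lim_vs // ?(eqP injg) ?capv0 //.
  by rewrite size_map szw dimU.
pose h : 'End(V) := (\1 + s^-1 *: f)%VF.
suff -> : <<[seq (p.1 + s *: p.2)%R | p <- w]>>%VS = ((g \o h) @: U)%VS by apply: ZU.
have curve y : g (f y) + s *: g y = (s *: (g \o h))%VF y.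
  rewrite scale_lfunE comp_lfunE -[s *: g y]linearZ -[s *: g (h y)]linearZ -linearD /=.
  congr (g _); rewrite add_lfunE id_lfunE scale_lfunE scalerDr scalerA divff // scale1r.
  by rewrite addrC.
rewrite (spanE _ g _ _ curve) => [|x]; last by rewrite scaler0 addr0.
(* [h] maps [U0] onto itself since [U0] is stable under [f]. *)
rewrite limgZ // {1}UE limgD; congr (_ + _)%VS; rewrite limg_comp.
congr (g @: _)%VS; apply/esym/eqP; rewrite eqEdim.
rewrite limg_dim_eq ?(eqP (injf _)) ?capv0 // leqnn andbT.
apply/subvP=> _ /memv_imgP [x U0x ->].
rewrite add_lfunE id_lfunE scale_lfunE memvD // memvZ //.
by apply: (subvP (lim_core_stable ffU)); rewrite memv_img.
Qed.

Section LimitModule.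
Variables (K : fieldType) (A : falgType K) (n : nat) (e : 'I_n -> A).
Variables (P : fdmod A).
Implicit Types (C : submodule P) (f : 'End(P)).

Definition stable_under (D : submodule P) (f : 'End(P)) : Prop := (f @: D <= D)%VS.

Lemma stableP (D : submodule P) f :
  stable_under D f <-> forall v, v \in (D : {vspace P}) -> f v \in (D : {vspace P}).
Proof.
split=> [Df v Dv|Df]; first by apply: (subvP Df); rewrite memv_img.
by apply/subvP=> _ /memv_imgP [v Dv ->]; apply: Df.
Qed.

Lemma lim_stable C f : f \in fdhom P P ->
  forall a, (act P a @: lim_vs f C <= lim_vs f C)%VS.
Proof.
move=> /homE hf a; rewrite limgD addvS //; apply/subvP=> _ /memv_imgP [v Hv ->].
  move/lim_coreP: Hv => [Cv Cfv].
  by apply/lim_coreP; rewrite hf; split; apply: submodule_act.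
by move/memv_imgP: Hv => [c Cc ->]; rewrite -hf memv_img // submodule_act.
Qed.

Lemma act_idem_img (x : A) C : idempotent_elt x ->
  (act P x @: C)%VS = (limg (act P x) :&: C)%VS.
Proof.
move=> idx; apply/vspaceP=> v; rewrite memv_cap; apply/idP/andP.
  move=> xv; split; first exact: subvP (limgS _ (subvf _)) _ xv.
  exact: subvP (sm_stable C x) _ xv.
move=> [/memv_imgP [u _ vE] Cv].
have -> : v = act P x v by rewrite vE -comp_lfunE -actM idx.
exact: memv_img.
Qed.

Lemma dim_vector_quot C i : idempotent_elt (e i) ->
  dim_vector e (quot_mod C) i = (\dim (limg (act P (e i))) - \dim (act P (e i) @: C))%N.
Proof.
move=> ide; rewrite act_idem_img // -(limg_ker_dim (quot_proj C)) lker_quot_proj addKn.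
rewrite /dim_vector -limg_comp; have /fdhomP -> := quot_proj_hom C.
by rewrite limg_comp limg_quot_proj.
Qed.

(** Taking the limit commutes with cutting by an idempotent, so that the limit
    keeps the dimension vector. *)
Lemma act_lim_vs (x : A) C f : idempotent_elt x -> f \in fdhom P P ->
  (act P x @: lim_vs f C)%VS = lim_vs f (act P x @: C).
Proof.
move=> idx hf; rewrite limgD; congr (_ + _)%VS; last first.
  by rewrite -!limg_comp; move/fdhomP: hf => ->.
move/homE: hf => hf.
have fixx u : u \in (act P x @: C)%VS -> act P x u = u.
  by move=> /memv_imgP [c _ ->]; rewrite -comp_lfunE -actM idx.
apply/vspaceP=> v; apply/memv_imgP/lim_coreP.
  by move=> [u /lim_coreP [Cu Cfu] ->]; rewrite hf !memv_img.
move=> [xv xfv]; have toC := subvP (sm_stable C x).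
by exists v; rewrite ?fixx //; apply/lim_coreP; rewrite !toC.
Qed.

Lemma GrassT_lim (d : 'I_n -> nat) C f : (forall i, idempotent_elt (e i)) ->
  rad_end 0 f -> (f @: (f @: C) <= C)%VS -> GrassT e d C -> GrassT e d (lim_vs f C).
Proof.
move=> ide [hf f0] ffC [dimC [C' /submodule_inj -> [CJ dC]]].
split; first by rewrite dim_lim_vs.
exists (Submodule (lim_stable C hf)) => //; split=> [|i] /=.
  rewrite subv_add (subv_trans (capvSl _ _) CJ) /=.
  by apply: subv_trans f0; apply: limgS (subvf _).
rewrite -dC !dim_vector_quot //= act_lim_vs // dim_lim_vs //.
have fx (U : {vspace P}) : (f @: (act P (e i) @: U) = act P (e i) @: (f @: U))%VS.
  by move/fdhomP: hf => hf; rewrite -!limg_comp hf.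
by rewrite !fx limgS.
Qed.

End LimitModule.

(** * Fixed points in the closure of an orbit *)

Section Degenerate.
Variables (K : closedFieldType) (A : falgType K) (n : nat) (e : 'I_n -> A).
Hypothesis ide : forall i, idempotent_elt (e i).
Variables (P : fdmod A) (d : 'I_n -> nat) (C : submodule P).
Let k := (\dim {:P} - \sum_i d i)%N.

(** The point [D] of the Grassmannian, with all of its [Aut_u]-orbit, lies in the
    closure of the orbit of [C]. Asking this of the whole orbit lets limits be
    iterated without knowing that translations by [Aut_u] preserve closed sets. *)
Definition reachable (D : submodule P) : Prop :=
  GrassT e d D /\
  forall Z, zariski_closed k Z -> (forall E, Aut_u_orbit C E -> Z E) ->
    forall g, Aut_u g -> Z (g @: D)%VS.

(** One limit step: the limit of the [(1 + t f) D] is stable under [f], and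
    remains stable under [Hom(P, J^(j+2) P)] and the maps in the list [l]. *)
Lemma reachable_step j (l : seq 'End(P)) f (D : submodule P) :
    rad_end j f -> (forall v, v \in l -> rad_end j v) ->
    reachable D -> (forall v, rad_end j.+1 v \/ v \in l -> stable_under D v) ->
  exists D' : submodule P, reachable D' /\
    forall v, rad_end j.+1 v \/ v \in f :: l -> stable_under D' v.
Proof.
move=> fj lj [gD rD] sD; have f0 := rad_end_le fj; have [hf _] := f0.
have sub1 v : rad_end j.+1 v ->
    forall u, u \in (D : {vspace P}) -> v u \in (D : {vspace P}).
  by move=> vj; apply/stableP/sD; left.
have ff : rad_end j.+1 (f \o f)%VF by apply: rad_end_mulr.
have ffD : (f @: (f @: D) <= D)%VS by rewrite -limg_comp; apply: sD; left.
exists (Submodule (lim_stable D hf)); split.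
  split=> [|Z closedZ CZ g gu]; first exact: GrassT_lim.
  apply: (zariski_closed_lim closedZ) => //; first by case: gD.
  - exact: Aut_u_inj gu.
  - by move=> t; rewrite rad_end_unipotent_inj //; apply: rad_endZ.
  - by move=> t; apply: rD => //; apply: Aut_u_comp => //; apply: rad_endZ.
move=> v Hv; apply/stableP=> u /=.
have vj : rad_end j v.
  by case: Hv => [/rad_end_pred|]; last by rewrite inE => /orP [/eqP ->|/lj].
have v0 := rad_end_le vj; have vf := rad_end_mulr vj f0.
have fv := rad_end_mull f0 vj; have fvf := rad_end_mulr (rad_end_pred fv) f0.
(* The maps [f v], [v f] and [f v f] send [P] to [J^(j+2) P], hence stabilise
   [D]; and [v] itself stabilises [D] or is equal to [f]. *)
move=> /memv_addP [c /lim_coreP [Dc Dfc] [_ /memv_imgP [c' Dc' ->] ->]].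
rewrite linearD memvD // (subvP (addvSl _ _)) //; apply/lim_coreP; last first.
  by split; [have := sub1 _ vf _ Dc' | have := sub1 _ fvf _ Dc']; rewrite !comp_lfunE.
split; last by have := sub1 _ fv _ Dc; rewrite comp_lfunE.
case: Hv => [vj1|]; first exact: sub1.
rewrite inE => /orP [/eqP -> //|vl].
by have /stableP : stable_under D v; [apply: sD; right | apply].
Qed.

Lemma reachable_self : GrassT e d C -> reachable C.
Proof. by move=> gC; split=> // Z _ CZ g gu; apply: CZ; exists g. Qed.

Lemma reachable_list j (l : seq 'End(P)) (D : submodule P) :
    (forall v, v \in l -> rad_end j v) -> reachable D ->
    (forall v, rad_end j.+1 v -> stable_under D v) ->
  exists D' : submodule P, reachable D' /\
    forall v, rad_end j.+1 v \/ v \in l -> stable_under D' v.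
Proof.
move=> + rD sD; elim: l => [_|f l IHl lj]; first by exists D; split=> // v [/sD|].
have [v vl|D' [rD' sD']] := IHl; first by apply: lj; rewrite inE vl orbT.
apply: reachable_step sD' => // [|v vl]; first by apply: lj; rewrite mem_head.
by apply: lj; rewrite inE vl orbT.
Qed.

(** The closure of an orbit of the unipotent group contains a fixed point. *)
Lemma reachable_fixed_point : GrassT e d C -> exists D : submodule P,
  reachable D /\ forall f, rad_end 0 f -> stable_under D f.
Proof.
move=> gC; have [m rm] := rad_end_nilpotent P.
have : exists D : submodule P, reachable D /\ forall f, rad_end m f -> stable_under D f.
  exists C; split=> [|f /rm ->]; first exact: reachable_self.
  by rewrite /stable_under lim0g sub0v.
elim: m {rm} => // m IHm [D [rD sD]]; apply: IHm.
have [l [lm ml]] := rad_end_span P m.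
have [D' [rD' sD']] := reachable_list lm rD sD; exists D'; split=> // f /ml lf.
apply/stableP=> u Du; move: lf; have -> : l = in_tuple l by [].
move/coord_span => ->; rewrite sum_lfunE memv_suml // => i _.
rewrite scale_lfunE memvZ //; apply/stableP: u Du; apply: sD'; right.
by rewrite mem_nth.
Qed.

Lemma reachable_closure (D : submodule P) : reachable D ->
  closure_in k (GrassT e d) (Aut_u_orbit C) D.
Proof.
move=> [gD rD]; split=> // Z closedZ CZ; rewrite -[X in Z X]lim1g.
apply: rD => //; apply/Aut_uE; exists 0; first exact: rad_end0.
by rewrite addr0.
Qed.
End Degenerate.

(** * Stable submodules *)

Section Stabiliser.
Variables (K : fieldType) (A : falgType K) (P : fdmod A).
Implicit Types C D : submodule P.

Lemma orbit_self C : Aut_u_orbit C C.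
Proof.
exists \1%VF; last by rewrite lim1g.
by apply/Aut_uE; exists 0; [exact: rad_end0 | rewrite addr0].
Qed.

Lemma orbit_stable C : (forall D : {vspace P}, Aut_u_orbit C D <-> D = C) <->
  (forall f, rad_end 0 f -> stable_under C f).
Proof.
split=> [oC f f0|sC D].
  apply/stableP=> v Cv.
  have : ((\1 + f)%VF @: C)%VS = C.
    by apply/oC; exists (\1 + f)%VF => //; apply/Aut_uE; exists f.
  have -> : f v = (\1 + f)%VF v - v by rewrite add_lfunE id_lfunE addrC addKr.
  by have := memv_img (\1 + f)%VF Cv => /[swap] -> gv; rewrite memvB.
split=> [[g gu ->]|->]; last exact: orbit_self.
apply/eqP; rewrite eqEdim limg_dim_eq ?(eqP (Aut_u_inj gu)) ?capv0 // leqnn andbT.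
have [f f0 ->] := (Aut_uE g).1 gu.
apply/subvP=> _ /memv_imgP [v Cv ->]; rewrite add_lfunE id_lfunE memvD //.
by have /stableP := sC _ f0; apply.
Qed.

(** An isomorphism [P/D -> P/C] lifts to an endomorphism [h] of [P], which is
    surjective by Nakayama's lemma since [C] lies in [JP]. It maps [D] into [C],
    hence onto [C] by equality of dimensions, and conjugation by [h] preserves
    [Hom(P, JP)]. *)
Lemma stable_iso C D : projective_mod P -> (C <= rad_mod P)%VS -> \dim C = \dim D ->
  mod_iso (quot_mod D) (quot_mod C) ->
  (forall f, rad_end 0 f -> stable_under D f) ->
  forall f, rad_end 0 f -> stable_under C f.
Proof.
move=> projP CJ dimCD [phi [hphi kphi fphi]] sD f [hf f0].
have [h hh hE] := projP _ _ _ (phi \o quot_proj D)%VF (quot_proj_hom C) (limg_quot_proj C)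
  (hom_comp hphi (quot_proj_hom D)).
have limg_stable a : (act P a @: limg h <= limg h)%VS.
  by move/fdhomP: hh => hh; rewrite -limg_comp -hh limg_comp limgS ?subvf.
have fullh : limg h = fullv.
  apply: (@nakayama _ _ _ (Submodule limg_stable)); apply/eqP; rewrite eqEsubv subvf /=.
  apply/subvP=> v _; have : quot_proj C v \in limg (quot_proj C \o h)%VF.
    by rewrite hE limg_comp limg_quot_proj fphi memvf.
  move=> /memv_imgP [u _ vE].
  rewrite -[v](subrK (h u)) addrC memv_add ?memv_img ?memvf //.
  apply: (subvP CJ); rewrite -quot_proj_eq0 linearB subr_eq0.
  by apply/eqP; apply: etrans vE (comp_lfunE _ _ _).
have kerh : lker h == 0%VS.
  rewrite -dimv_eq0 -(eqn_add2r (\dim (limg h))) add0n -{1}[lker h]capfv limg_ker_dim.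
  by rewrite fullh.
have hD : (h @: D)%VS = C.
  apply/eqP; rewrite eqEdim limg_dim_eq ?(eqP kerh) ?capv0 // dimCD leqnn andbT.
  apply/subvP=> _ /memv_imgP [v Dv ->].
  rewrite -quot_proj_eq0 -comp_lfunE hE comp_lfunE.
  by move: Dv; rewrite -quot_proj_eq0 => /eqP ->; rewrite linear0.
have hhV : (h^-1)%VF \in fdhom P P by apply: hom_inv => //; apply/eqP.
have conj0 : rad_end 0 (h^-1 \o (f \o h))%VF.
  split; first by do 2?apply: hom_comp.
  rewrite !limg_comp fullh; apply: subv_trans (limgS _ f0) _; exact: hom_rad_rad.
have := sD _ conj0; rewrite /stable_under => /(limgS h).
by rewrite -limg_comp !lker0_compVKf ?limg_comp ?hD //; rewrite lker0_limgf.
Qed.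

End Stabiliser.

Section Precomposition.
Variables (K : fieldType) (M N Q : vectType K) (p : 'Hom(M, N)).

(** Composition with [p] on the right, as a linear map. *)
Definition precomp (f : 'Hom(N, Q)) : 'Hom(M, Q) := (f \o p)%VF.
Fact precomp_linear : linear precomp.
Proof. by move=> c f g; rewrite /precomp comp_lfunDl comp_lfunZl. Qed.
HB.instance Definition _ :=
  GRing.isLinear.Build K 'Hom(N, Q) 'Hom(M, Q) _ precomp precomp_linear.
End Precomposition.

Section MDim.
Variables (K : fieldType) (A : falgType K) (P : fdmod A) (C : submodule P).

(** Composition with the projection identifies [Hom(P/C, Q)] with the maps in
    [Hom(P, Q)] that vanish on [C]. *)
Lemma dim_hom_quot_eq (Q : fdmod A) :
  \dim (fdhom (quot_mod C) Q) = \dim (fdhom P Q) <->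
  (forall g, g \in fdhom P Q -> forall c, c \in C -> g c = 0).
Proof.
pose pre := linfun (@precomp _ _ _ Q (quot_proj C)).
have preE f : pre f = (f \o quot_proj C)%VF by rewrite lfunE.
have ker_pre : (fdhom (quot_mod C) Q :&: lker pre = 0)%VS.
  apply/eqP; rewrite -subv0; apply/subvP=> f.
  rewrite memv_cap memv_ker preE memv0 => /andP [_ /eqP f0]; apply/eqP/lfunP=> x.
  have : x \in limg (quot_proj C) by rewrite limg_quot_proj memvf.
  by move=> /memv_imgP [v _ ->]; rewrite -comp_lfunE f0 !zero_lfunE.
have sub_pre : (pre @: fdhom (quot_mod C) Q <= fdhom P Q)%VS.
  apply/subvP=> _ /memv_imgP [f hf ->]; rewrite preE.
  exact: hom_comp (quot_proj_hom C).
rewrite -(limg_dim_eq ker_pre); split=> [dimE g|kills].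
  have /eqP <- : (pre @: fdhom (quot_mod C) Q == fdhom P Q)%VS.
    by rewrite eqEdim sub_pre dimE leqnn.
  move=> /memv_imgP [f _ ->] c Cc; rewrite preE comp_lfunE.
  by move: Cc; rewrite -quot_proj_eq0 => /eqP ->; rewrite linear0.
congr (\dim _); apply/eqP; rewrite eqEsubv sub_pre; apply/subvP=> g hg.
have [f hf ->] := hom_quot_factor hg (kills g hg).
by rewrite -preE memv_img.
Qed.

(** Every map [P -> JP/C] lifts to a map [P -> JP] along the projection. *)
Lemma mdim_eq0 : projective_mod P -> (C <= rad_mod P)%VS ->
  mdim C = 0 <-> forall f, rad_end 0 f -> stable_under C f.
Proof.
move=> projP CJ; pose Q := sub_mod (sub_quot C (rad_mod P)).
have mE : mdim C = 0 <-> \dim (fdhom (quot_mod C) Q) = \dim (fdhom P Q).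
  by rewrite /mdim; split=> [/eqP|->]; rewrite ?subrr // subr_eq0 => /eqP [->].
rewrite mE dim_hom_quot_eq; split=> [kills f [hf f0]|sC g hg c Cc].
  apply/stableP=> v Cv.
  have fQ : (limg (quot_proj C \o f)%VF <= sub_quot C (rad_mod P))%VS.
    by rewrite limg_comp limgS.
  have [g hg gE] := hom_corestrict (hom_comp (quot_proj_hom C) hf) fQ.
  by rewrite -quot_proj_eq0 -comp_lfunE gE comp_lfunE kills // linear0.
have [hg' gQ] := hom_incl hg.
have [h hh hE] := projP _ _ _ _ (quot_proj_hom C) (limg_quot_proj C) hg'.
have h0 : rad_end 0 h.
  split=> //; apply/subvP=> _ /memv_imgP [v _ ->].
  have : (incl _ \o g)%VF v \in (quot_proj C @: rad_mod P)%VS.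
    by rewrite (subvP gQ) // memv_img ?memvf.
  rewrite -hE comp_lfunE => /memv_imgP [w Jw E].
  rewrite -[h v](subrK w) memvD // (subvP CJ) // -quot_proj_eq0 linearB subr_eq0.
  exact/eqP.
have := sC _ h0; move/stableP/(_ c Cc); rewrite -quot_proj_eq0 -comp_lfunE hE.
by rewrite comp_lfunE inclE => /eqP g0; apply: val_inj.
Qed.
End MDim.

Theorem mainTheorem7 (K : closedFieldType) (A : falgType K)
    (n : nat) (e : 'I_n -> A) (he : basic_idempotents e)
    (T P : fdmod A) (hT : semisimple_mod T) (hP : is_projective_cover P T)
    (d : 'I_n -> nat)
    (M : fdmod A) (C : submodule P)
    (hC : GrassT e d C) (hM : mod_iso M (quot_mod C)) :
  [<-> ~ (exists M' : fdmod A,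
            unipotent_top_stable_degeneration e d C M' /\ ~ mod_iso M' M);
       forall D : {vspace P}, Aut_u_orbit C D <-> D = C;
       forall f, f \in fdhom P (sub_mod (rad_mod P)) ->
         ((incl (rad_mod P) \o f)%VF @: C <= C)%VS;
       mdim C = 0].
Proof.
have [projP _] := hP.
have ide i : idempotent_elt (e i) by case: he => [[prim _ _] _]; case: (prim i).
have [dimC [C' /submodule_inj EC [CJ _]]] := hC; rewrite {}EC in CJ.
have stableE : (forall f, f \in fdhom P (sub_mod (rad_mod P)) ->
    ((incl (rad_mod P) \o f)%VF @: C <= C)%VS) <->
    forall f, rad_end 0 f -> stable_under C f.
  split=> [sC f [hf f0]|sC f /hom_incl]; last exact: sC.
  by have [g /sC sg ->] := hom_corestrict hf f0.
tfae.
- move=> noproper; apply/orbit_stable.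
  have [D [rD sD]] := reachable_fixed_point ide hC; have [[dimD _] _] := rD.
  (* [P/D] is a degeneration of [M], so it is isomorphic to [M]. *)
  apply: (stable_iso projP CJ _ _ sD); first by rewrite dimC dimD.
  apply: contrapT => niso; apply: noproper; exists (quot_mod D); split.
    by exists D; [exact: reachable_closure | exact: mod_iso_refl].
  by move=> iso; apply: niso; apply: mod_iso_trans iso hM.
- by move=> /orbit_stable /stableE.
- by move=> /stableE /(mdim_eq0 projP CJ).
- move=> /(mdim_eq0 projP CJ) /orbit_stable oC [M' [[D [_ clD] isoD] niso]].
  have /submodule_inj ED : D = C :> {vspace P}.
    by apply: (clD (fun E => E = C)) => [|E /oC //]; apply: zariski_closed_point.
  by apply: niso; rewrite ED in isoD; apply: mod_iso_trans isoD (mod_iso_sym hM).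
Qed.
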